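(* Let $p\in\mathbf{P}$ be a propositional variable. The formula $[\bullet p]\neg\bullet p$ is not provable in $\mathbf{M}^{\circ[\cdot]}$.
   Context: Fix a nonempty set $\mathbf{P}$ of propositional variables. The language is $\mathcal{L}(\bullet)$ extended with public announcements: $\varphi::=p\mid\neg\varphi\mid\varphi\land\varphi\mid\bullet\varphi\mid[\varphi]\varphi$ with $p\in\mathbf{P}$; other Boolean connectives are defined as usual and $\circ\varphi$ abbreviates $\neg\bullet\varphi$. The proof system $\mathbf{M}^{\circ[\cdot]}$ has as axioms all instances (in this language) of: propositional tautologies; $\circ\texttt{E}$: $\bullet\varphi\to\varphi$; $\circ\texttt{M}$: $\circ\varphi\land\varphi\to\circ(\varphi\lor\psi)$; and the reduction axioms $\texttt{AP}$: $[\psi]p\leftrightarrow(\psi\to p)$ for $p\in\mathbf{P}$; $\texttt{AN}$: $[\psi]\neg\varphi\leftrightarrow(\psi\to\neg[\psi]\varphi)$; $\texttt{AC}$: $[\psi](\varphi\land\chi)\leftrightarrow([\psi]\varphi\land[\psi]\chi)$; $\texttt{AA}$: $[\psi][\chi]\varphi\leftrightarrow[\psi\land[\psi]\chi]\varphi$; $\texttt{A}\bullet$: $[\psi]\bullet\varphi\leftrightarrow(\psi\to\bullet[\psi]\varphi)$. Its rules are modus ponens and $\texttt{RE}\circ$: from $\varphi\leftrightarrow\psi$ infer $\circ\varphi\leftrightarrow\circ\psi$. *)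

(* Defs.v *)
Set Implicit Arguments.
Unset Strict Implicit.

Inductive form (P : Type) : Type :=
| Var (p : P)
| Neg (f : form P)
| And (f g : form P)
| Bullet (f : form P)
| Ann (f g : form P).

Definition Or (P : Type) (f g : form P) : form P := Neg (And (Neg f) (Neg g)).
Definition Imp (P : Type) (f g : form P) : form P := Neg (And f (Neg g)).
Definition Iff (P : Type) (f g : form P) : form P := And (Imp f g) (Imp g f).
Definition Circ (P : Type) (f : form P) : form P := Neg (Bullet f).

Declare Scope form_scope.
Delimit Scope form_scope with form.
Bind Scope form_scope with form.

Notation "¬ f" := (Neg f) (at level 35, right associativity) : form_scope.
Notation "● f" := (Bullet f) (at level 35, right associativity) : form_scope.
Notation "○ f" := (Circ f) (at level 35, right associativity) : form_scope.
Notation "⟦ f ⟧ g" := (Ann f g)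
  (at level 35, f at level 200, g at level 35, right associativity,
   format "⟦ f ⟧ g") : form_scope.
Notation "f ∧ g" := (And f g) (at level 80, right associativity) : form_scope.
Notation "f ∨ g" := (Or f g) (at level 85, right associativity) : form_scope.
Notation "f ⇒ g" := (Imp f g) (at level 90, right associativity) : form_scope.
Notation "f ⇔ g" := (Iff f g) (at level 95, no associativity) : form_scope.

(* Purely propositional schemes, with schematic letters indexed by [nat]:
   an instance of a tautology is a substitution instance of one of these. *)
Inductive pform : Type :=
| PVar (n : nat)
| PNeg (a : pform)
| PAnd (a b : pform).

Fixpoint peval (v : nat -> bool) (a : pform) : bool :=
  match a with
  | PVar n => v n
  | PNeg b => negb (peval v b)
  | PAnd b c => andb (peval v b) (peval v c)
  end.

Definition tautology (a : pform) : Prop := forall v : nat -> bool, peval v a = true.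

Fixpoint psubst (P : Type) (s : nat -> form P) (a : pform) : form P :=
  match a with
  | PVar n => s n
  | PNeg b => Neg (psubst s b)
  | PAnd b c => And (psubst s b) (psubst s c)
  end.

Inductive provable (P : Type) : form P -> Prop :=
| ax_taut (a : pform) (s : nat -> form P) :
    tautology a -> provable (psubst s a)
| ax_circE (f : form P) : provable (● f ⇒ f)
| ax_circM (f g : form P) : provable (○ f ∧ f ⇒ ○ (f ∨ g))
| ax_AP (h : form P) (p : P) : provable (⟦h⟧ Var p ⇔ (h ⇒ Var p))
| ax_AN (h f : form P) : provable (⟦h⟧ ¬ f ⇔ (h ⇒ ¬ ⟦h⟧ f))
| ax_AC (h f g : form P) : provable (⟦h⟧ (f ∧ g) ⇔ (⟦h⟧ f ∧ ⟦h⟧ g))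
| ax_AA (h g f : form P) : provable (⟦h⟧ ⟦g⟧ f ⇔ ⟦h ∧ ⟦h⟧ g⟧ f)
| ax_AB (h f : form P) : provable (⟦h⟧ ● f ⇔ (h ⇒ ● ⟦h⟧ f))
| rule_MP (f g : form P) : provable f -> provable (f ⇒ g) -> provable g
| rule_RE (f g : form P) : provable (f ⇔ g) -> provable (○ f ⇔ ○ g).

(* Main.v *)
(* In a model whose neighbourhood functions are empty, [○ f] means "[f] is false", so
   [● f] is equivalent to [f]. On a single world where all variables hold, reading
   [⟦h⟧ f] as the implication [h → f] then validates the whole system, whereas
   [⟦● p⟧ ¬ ● p] becomes [p → ¬ p], which fails. *)
Require Import Defs.
From Stdlib Require Import Bool.

Fixpoint eval {P : Type} (f : form P) : bool :=
  match f with
  | Var _ => true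
  | Neg f => negb (eval f)
  | And f g => eval f && eval g
  | Bullet f => eval f
  | Ann h f => implb (eval h) (eval f)
  end.

Lemma eval_psubst (P : Type) (s : nat -> form P) (a : pform) :
  eval (psubst s a) = peval (fun n => eval (s n)) a.
Proof. induction a; simpl; congruence. Qed.

(** Soundness: each axiom becomes a Boolean tautology in the values of its schematic formulas, and
    both rules preserve value [true]. *)
Lemma eval_provable (P : Type) (f : form P) : provable f -> eval f = true.
Proof.
  induction 1 as [a s Ha|f|f g|h q|h f|h f g|h g f|h f|f g _ IHf _ IHfg|f g _ IH];
    simpl in *.
  - rewrite eval_psubst. apply Ha.
  - now destruct (eval f).
  (* The premise of [ax_circM] reads as [¬ f ∧ f], so the axiom holds vacuously. *)
  - now destruct (eval f), (eval g).
  - now destruct (eval h).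
  - now destruct (eval h), (eval f).
  - now destruct (eval h), (eval f), (eval g).
  (* For [ax_AA] this is currying, as [h ∧ (h ⇒ g)] amounts to [h ∧ g]. *)
  - now destruct (eval h), (eval f), (eval g).
  - now destruct (eval h), (eval f).
  - now destruct (eval f), (eval g).
  - now destruct (eval f), (eval g).
Qed.

Theorem proposition6p4 (P : Type) (p : P) :
  ~ provable (⟦● Var p⟧ ¬ ● Var p)%form.
Proof.
  (* The value computes to [implb true (negb true)], which is [false]. *)
  intros H. apply eval_provable in H. discriminate H.
Qed.
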